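(* There is a constant $C>0$ such that every interval graph $G$ on $n$ vertices satisfies $\mathrm{sd}(G)\le C\sqrt[3]{n}$.
   Context: An interval graph is the intersection graph of a finite family of intervals on the real line. For a graph $G$ and distinct vertices $u,v$, $\mathrm{sd}_G(u,v)$ is the number of vertices other than $u,v$ that are adjacent to exactly one of $u$ and $v$. The symmetric difference of $G$ is $\mathrm{sd}(G)=\max_H \min_{u\ne v\in V(H)} \mathrm{sd}_H(u,v)$, the maximum taken over all induced subgraphs $H$ of $G$ with at least two vertices. *)

(* Defs.v *)
From HB Require Import structures.
From mathcomp Require Import all_boot all_order all_algebra.
From mathcomp Require Import reals exp.

Set Implicit Arguments.
Unset Strict Implicit.
Unset Printing Implicit Defensive.

Record sgraph := SGraph {
  vertex :> finType;
  adj : rel vertex;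
  adj_sym : symmetric adj;
  adj_irrefl : irreflexive adj }.

Section Induced.
Variables (G : sgraph) (W : {set G}).

Definition induced_adj : rel {x : G | x \in W} :=
  fun x y => adj (val x) (val y).

Lemma induced_sym : symmetric induced_adj.
Proof. by move=> x y; apply: adj_sym. Qed.

Lemma induced_irrefl : irreflexive induced_adj.
Proof. by move=> x; apply: adj_irrefl. Qed.

Definition induced : sgraph := SGraph induced_sym induced_irrefl.
End Induced.

(* [interval R] covers all kinds of intervals: open, closed or half-open,
   bounded or not, degenerate or empty. An empty interval represents an isolated
   vertex, so allowing it does not enlarge the class of graphs. *)
Definition interval_graph (R : realType) (G : sgraph) : Prop :=
  exists I : G -> interval R, forall u v : G, u != v ->
    (adj u v <-> exists x : R, x \in I u /\ x \in I v).

Definition sd_pair (G : sgraph) (u v : G) : nat :=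
  #|[set w : G | [&& w != u, w != v & adj u w (+) adj v w]]|.

(* The default value [#|G|] is an upper bound of all the [sd_pair u v], hence it
   does not affect the minimum as soon as [G] has two distinct vertices. *)
Definition min_sd (G : sgraph) : nat :=
  \big[minn/#|G|]_(p : G * G | p.1 != p.2) sd_pair p.1 p.2.

Definition sd (G : sgraph) : nat :=
  \max_(W : {set G} | 2 <= #|W|) min_sd (induced W).

(* Main.v *)
(** For vertices [u], [v] of an interval graph, [sd u v] is at most
    [|x u - x v| + |y u - y v|], where [x] counts the intervals entirely to the
    left and [y] those entirely to the right. Suppose that [2k <= sd u v] for all
    [u != v]. The [k] intervals with the smallest right endpoints have [x < k],
    so their [y]-values are [k]-separated; hence, if [u0] is the last of them,
    at least [k(k-1)] intervals start no later than the right endpoint of [u0].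
    These also satisfy [x < k], so their [y]-values are [k]-separated as well,
    which forces [n >= k(k(k-1)-1)]. *)

Require Import Defs.
From HB Require Import structures.
From mathcomp Require Import all_boot all_order all_algebra.
From mathcomp Require Import boolp reals exp.
From mathcomp Require Import zify.

Set Implicit Arguments.
Unset Strict Implicit.
Unset Printing Implicit Defensive.

Import Order.TTheory GRing.Theory Num.Theory.
Local Open Scope ring_scope.

(** * Counting with separated natural numbers *)

Section NatDistance.
Local Open Scope nat_scope.

Definition dist (a b : nat) := (a - b) + (b - a).

(** Pigeonhole: cut [[m, M]] into blocks of length [k]; two separated values never share a block. *)
Lemma card_separated (T : finType) (A : {set T}) (f : T -> nat) (k m M : nat) :
    0 < k -> (forall u, u \in A -> m <= f u <= M) ->
    (forall u v, u \in A -> v \in A -> u != v -> k <= dist (f u) (f v)) ->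
  k * #|A|.-1 <= M - m.
Proof.
move=> k_gt0 fA sepA.
pose q u : 'I_((M - m) %/ k).+1 := inord ((f u - m) %/ k).
have qE u : u \in A -> q u = (f u - m) %/ k :> nat.
  move=> /fA /andP[mf fM]; rewrite inordK // ltnS leq_div2r //; lia.
have q_inj : {in A &, injective q}.
  move=> u v uA vA /(congr1 val) /=; rewrite !qE // => quv.
  apply/eqP/negPn/negP => /(sepA u v uA vA).
  have := fA u uA; have := fA v vA; rewrite /dist.
  have := divn_eq (f u - m) k; have := divn_eq (f v - m) k; rewrite quv.
  have := ltn_pmod (f u - m) k_gt0; have := ltn_pmod (f v - m) k_gt0.
  move: (_ %% _) (_ %% _) (_ * k) => *; lia.
have: #|A| <= ((M - m) %/ k).+1.
  by rewrite -(card_in_imset q_inj) -[X in _ <= X]card_ord max_card.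
move=> leA; apply: (@leq_trans (k * ((M - m) %/ k))); last by rewrite mulnC leq_divM.
by rewrite leq_mul2l -subn1 leq_subLR add1n leA orbT.
Qed.

Lemma exists_top_subset (T : finType) (f : T -> nat) (k : nat) : k <= #|T| ->
  exists2 S : {set T}, #|S| = k & forall u v, u \in S -> f u < f v -> v \in S.
Proof.
elim: k => [|k IHk] kT.
  by exists set0; rewrite ?cards0 // => u v; rewrite inE.
have [S cS topS] := IHk (ltnW kT).
have [x xS]: exists x, x \in ~: S.
  by apply/set0Pn; rewrite -card_gt0 cardsCs setCK cS; lia.
have [a aS amax] := @arg_maxnP _ x (mem (~: S)) f xS.
have {}aS : a \notin S by move: aS; rewrite /= inE.
exists (a |: S); first by rewrite cardsU1 aS cS.
move=> u v; rewrite !inE => /orP[/eqP-> | uS] fuv; last by rewrite (topS u) ?orbT.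
case: (boolP (v \in S)) => [_ | vS]; rewrite ?orbT //.
by have := amax v; rewrite /= inE vS => /(_ isT); lia.
Qed.

(** Turns each truncated subtraction in [dist] into the size of a set difference. *)
Lemma card_setD_chain (T : finType) (A B : {set T}) :
  (A \subset B) || (B \subset A) -> #|A :\: B| = #|A| - #|B|.
Proof.
case/orP => [AB | BA]; last by rewrite cardsD (setIidPr BA).
by have := subset_leq_card AB; rewrite -subn_eq0 => /eqP->; apply/eqP;
  rewrite cards_eq0 setD_eq0.
Qed.

End NatDistance.

(** * Interval orders as abstract relations *)

Section IntervalOrder.
Local Open Scope nat_scope.
Variables (T : finType) (P : rel T).
Hypothesis P_irr : irreflexive P.
(** The Ferrers condition, excluding 2+2; with irreflexivity, [w := v] gives transitivity. *)
Hypothesis P_ferrers : forall u v w z, P u v -> P w z -> P u z || P w v.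

Definition before (u : T) : {set T} := [set w | P w u].
Definition after (u : T) : {set T} := [set w | P u w].

Lemma before_chain u v : (before u \subset before v) || (before v \subset before u).
Proof.
apply/negPn/negP; rewrite negb_or => /andP[/subsetPn[w + +] /subsetPn[z + +]].
rewrite !inE => wu nwv zv nzu.
by have := P_ferrers wu zv; rewrite (negPf nwv) (negPf nzu).
Qed.

Lemma after_chain u v : (after u \subset after v) || (after v \subset after u).
Proof.
apply/negPn/negP; rewrite negb_or => /andP[/subsetPn[w + +] /subsetPn[z + +]].
rewrite !inE => uw nvw vz nuz.
by have := P_ferrers uw vz; rewrite (negPf nvw) (negPf nuz).
Qed.

Lemma card_after_lt u v w : P u w -> ~~ P v w -> #|after v| < #|after u|.
Proof.
move=> uw nvw; apply: proper_card; apply/properP; split; last first.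
  by exists w; rewrite inE.
have /orP[/subsetP/(_ w)|//] := after_chain u v.
by rewrite !inE uw (negPf nvw) => /(_ isT).
Qed.

Lemma separated_card (k : nat) : 0 < k -> k <= #|T| ->
    (forall u v, u != v -> k.*2 <= dist #|before u| #|before v|
                                   + dist #|after u| #|after v|) ->
  k * (k * k.-1).-1 <= #|T|.
Proof.
move=> k_gt0 kT sep.
(* A large [after] set stands for a small right endpoint. *)
have [S cS topS] := exists_top_subset (fun u => #|after u|) kT.
have [x xS]: exists x, x \in S by apply/set0Pn; rewrite -card_gt0 cS.
have [u0 /= u0S u0min] := @arg_minnP _ x (mem S) (fun u => #|after u|) xS.
(* Whatever is before [w] has a larger [after] set than [u0], hence lies in [S]; [u0] itself is not
   before [w], so the bound is strict. *)
have before_lt w : ~~ P u0 w -> #|before w| < k.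
  move=> nu0w; rewrite -cS; apply: proper_card; apply/properP; split.
    by apply/subsetP => z; rewrite inE => zw; apply: (topS u0) => //;
      apply: card_after_lt zw nu0w.
  by exists u0; rewrite ?inE.
have S_nafter u : u \in S -> ~~ P u0 u.
  move=> uS; apply/negP => u0u; have := u0min u uS.
  by have := card_after_lt u0u (negbT (P_irr u)); lia.
have sep_after u v : ~~ P u0 u -> ~~ P u0 v -> u != v ->
    k <= dist #|after u| #|after v|.
  move=> /before_lt bu /before_lt bv /sep; rewrite /dist; lia.
pose A := ~: after u0.
have cA : #|A| = #|T| - #|after u0| by rewrite [LHS]cardsCs setCK.
(* On [S] the [after] counts lie between [#|after u0|] and [#|T|], a range of length exactly
   [#|A|]. *)
have kA : k * k.-1 <= #|A|.
  rewrite -{2}cS cA; apply: (@card_separated _ S (fun u => #|after u|)) => //.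
    by move=> u uS; rewrite u0min //= max_card.
  by move=> u v uS vS; apply: sep_after; apply: S_nafter.
have: k * #|A|.-1 <= #|T| - 0.
  apply: (@card_separated _ A (fun u => #|after u|)) => //.
    by move=> u _; rewrite max_card.
  by move=> u v; rewrite !inE; apply: sep_after.
rewrite subn0; apply: leq_trans; rewrite leq_mul2l; lia.
Qed.

End IntervalOrder.

(** * From interval representations to interval orders *)

Section IntervalGraph.
Variables (R : realType) (G : sgraph) (I : G -> interval R).
Hypothesis adjI : forall u v : G, u != v ->
  (adj u v <-> exists x : R, x \in I u /\ x \in I v).

(* An empty interval precedes every nonempty one, and nothing precedes it; this
   keeps the Ferrers property without excluding empty intervals. *)
Definition precedes : rel G := fun u v =>
  `[< (exists y, y \in I v) /\
      forall x y, x \in I u -> y \in I v -> x < y >].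

Lemma precedes_irr : irreflexive precedes.
Proof. by move=> u; apply/asboolP => -[[y yu] /(_ y y yu yu)]; rewrite ltxx. Qed.

Lemma not_precedes u v : (exists y, y \in I v) -> ~~ precedes u v ->
  exists x y, [/\ x \in I u, y \in I v & y <= x].
Proof.
move=> vne /asboolP nuv; apply: contrapT => nex; apply: nuv; split=> // x y xu yv.
by rewrite ltNge; apply/negP => yx; apply: nex; exists x, y.
Qed.

(** A failure would give points with [x < y' <= x' < y <= x]. *)
Lemma precedes_ferrers u v w z :
  precedes u v -> precedes w z -> precedes u z || precedes w v.
Proof.
move=> /asboolP[vne uv] /asboolP[zne wz]; apply/negPn/negP; rewrite negb_or.
move=> /andP[/(not_precedes zne)[x [y [xu yz yx]]]].
move=> /(not_precedes vne)[x' [y' [x'w y'v y'x']]].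
have := lt_le_trans (uv _ _ xu y'v) y'x'.
by move/lt_trans => /(_ _ (wz _ _ x'w yz)); rewrite ltNge yx.
Qed.

Lemma mem_itv_convex (J : interval R) (x y z : R) :
  x \in J -> z \in J -> x <= y <= z -> y \in J.
Proof.
case: J => l r; rewrite !itv_boundlr => /andP[lx _] /andP[_ zr] /andP[xy yz].
by rewrite (le_trans lx) ?(le_trans _ zr) // bnd_simp.
Qed.

Lemma adj_not_precedes u v : u != v -> adj u v -> ~~ precedes u v.
Proof.
move=> /adjI -> [x [xu xv]]; apply/asboolP => -[_ /(_ x x xu xv)].
by rewrite ltxx.
Qed.

Lemma nonadj_precedes u w : u != w -> (exists y, y \in I w) -> ~~ adj u w ->
  precedes u w || precedes w u.
Proof.
move=> uw wne nadj; apply/negPn/negP; rewrite negb_or => /andP[nuw nwu].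
have [a [b [au bw ba]]] := not_precedes wne nuw.
have [c [d [cw du dc]]] := not_precedes (ex_intro _ a au) nwu.
move/negP: nadj; apply; apply/(adjI uw).
(* The larger of [b] and [d] lies in both intervals, by convexity. *)
have [bd|/ltW db] := leP b d.
  by exists d; split=> //; apply: (mem_itv_convex bw cw) => //; rewrite bd.
by exists b; split=> //; apply: (mem_itv_convex du au) => //; rewrite db.
Qed.

(** Meeting [u] makes [w] nonempty and incomparable to [u]; missing [v] then makes it comparable to
    [v]. *)
Lemma adj_xor_precedes u v w : w != u -> w != v -> adj u w -> ~~ adj v w ->
  (w \in before precedes v :\: before precedes u)
  || (w \in after precedes v :\: after precedes u).
Proof.
move=> wu wv uw nvw; have uw' : u != w by rewrite eq_sym.
have wne : exists y, y \in I w by have [x []] := (adjI uw').1 uw; exists x.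
rewrite !inE (adj_not_precedes uw') // adj_not_precedes 1?adj_sym //=.
by rewrite orbC nonadj_precedes // eq_sym.
Qed.

Lemma sd_pair_le_dist u v :
  (sd_pair u v <= dist #|before precedes u| #|before precedes v|
                  + dist #|after precedes u| #|after precedes v|)%N.
Proof.
have Fer := @precedes_ferrers.
rewrite /dist -!card_setD_chain ?(before_chain Fer) ?(after_chain Fer) //.
set A := _ :\: _; set B := _ :\: _; set C := _ :\: _; set D := _ :\: _.
apply: (@leq_trans #|(A :|: B) :|: (C :|: D)|); last first.
  apply: leq_trans (leq_card_setU _ _) _.
  by apply: leq_add; apply: leq_card_setU.
apply/subset_leq_card/subsetP => w; rewrite in_set => /and3P[wu wv].
rewrite !(in_setU w).
case uw: (adj u w); case vw: (adj v w) => //= _.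
  by have /orP[->|->] := adj_xor_precedes wu wv uw (negbT vw); rewrite ?orbT.
by have /orP[->|->] := adj_xor_precedes wv wu vw (negbT uw); rewrite ?orbT.
Qed.

End IntervalGraph.

(** * The cubic bound and its cube root *)

Lemma interval_graph_induced (R : realType) (G : sgraph) (W : {set G}) :
  interval_graph R G -> interval_graph R (induced W).
Proof.
by case=> I adjI; exists (fun u => I (val u)) => u v uv; apply: adjI.
Qed.

Lemma min_sd_le_pair (G : sgraph) (u v : G) : u != v -> (min_sd G <= sd_pair u v)%N.
Proof.
move=> uv; rewrite /min_sd -minEnat -leEnat.
exact: (bigmin_le_cond _ (j := (u, v)) (fun p : G * G => sd_pair p.1 p.2)).
Qed.

Lemma min_sd_le_card (G : sgraph) : (min_sd G <= #|G|)%N.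
Proof. by rewrite /min_sd -minEnat -leEnat; apply: bigmin_le_id. Qed.

Lemma min_sd_cube (R : realType) (G : sgraph) : interval_graph R G ->
  (min_sd G ^ 3 <= 125 * #|G|)%N.
Proof.
case=> I adjI; set s := min_sd G.
have sG : (s <= #|G|)%N := min_sd_le_card G.
have [k0|k_gt0] := posnP s./2.
  have s1 : (s <= 1)%N by lia.
  have : (s ^ 3 <= s)%N by case: s s1 {sG k0} => [|[]].
  lia.
(* The worst case is [s = 3], where halving loses most. *)
have s3 : (s <= 3 * s./2)%N.
  by have := odd_double_half s; move: k_gt0; case: (odd s) => /=; lia.
have kG : (s./2 <= #|G|)%N by lia.
have := separated_card (@precedes_irr R G I) (@precedes_ferrers R G I) k_gt0 kG.
have sep u v : u != v ->
    (s./2.*2 <= dist #|before (precedes I) u| #|before (precedes I) v|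
            + dist #|after (precedes I) u| #|after (precedes I) v|)%N.
  move=> uv; apply: leq_trans (sd_pair_le_dist adjI u v).
  by apply: leq_trans (min_sd_le_pair uv); rewrite -/s; lia.
move=> /(_ sep); move: (s./2) k_gt0 kG s3 => k k_gt0 kG s3k kkG.
(* For [k = 1] the bound [kkG] is void and [kG] is used instead; for [k >= 2],
   [k ^ 2 <= 4 * (k * (k - 1) - 1)], with equality at 2. *)
have k3 : (k ^ 3 <= 4 * #|G|)%N.
  case: k k_gt0 kG kkG {s3k} => [|[|k]] // _; first by lia.
  by rewrite !expnS expn0; nia.
(* This gives 27 * 4 = 108, rounded up to the cube 125. *)
apply: (@leq_trans ((3 * k) ^ 3)); first by rewrite leq_exp2r.
by rewrite expnMn; lia.
Qed.

Lemma sd_cube (R : realType) (G : sgraph) : interval_graph R G ->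
  (sd G ^ 3 <= 125 * #|G|)%N.
Proof.
move=> intG; rewrite /sd.
elim/big_ind: _ => // [a b|W _]; first by rewrite /maxn; case: ifP.
apply: leq_trans (min_sd_cube (interval_graph_induced W intG)) _.
by rewrite leq_mul2l card_sig max_card.
Qed.

Unset Implicit Arguments.

Theorem theorem6 (R : realType) :
  exists C : R, 0 < C /\
    forall G : sgraph, interval_graph R G ->
      (sd G)%:R <= C * (#|G|%:R `^ (3%:R)^-1).
Proof.
(* 5 is the cube root of the 125 in [sd_cube]. *)
exists 5%:R; split=> [|G intG]; first by rewrite ltr0n.
rewrite -(@ler_pXn2r _ 3) ?nnegrE ?mulr_ge0 ?powR_ge0 ?ler0n //.
rewrite exprMn -[X in _ * X]powR_mulrn ?powR_ge0 // -powRrM mulVf ?pnatr_eq0 //.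
rewrite powRr1 ?ler0n // -!natrX -natrM ler_nat.
exact: sd_cube intG.
Qed.
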